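(* The discontinuities of $\alpha_3$ lying in the set $(\mathbb Q\cap[2,3])^3$ are, up to permutation of coordinates, exactly the following twelve points, with the indicated values of $\alpha_3$: $$\begin{aligned} \alpha_3(2,2,2)&=8, & \alpha_3(5/2,5/2,8/3)&=11,\\ \alpha_3(2,2,3)&=12, & \alpha_3(8/3,8/3,8/3)&=12,\\ \alpha_3(2,3,3)&=18, & \alpha_3(11/5,11/4,11/4)&=11,\\ \alpha_3(2,5/2,5/2)&=10, & \alpha_3(11/4,11/4,11/4)&=13,\\ \alpha_3(5/2,5/2,3)&=15, & \alpha_3(14/5,14/5,14/5)&=14,\\ \alpha_3(9/4,7/3,5/2)&=9, & \alpha_3(3,3,3)&=27. \end{aligned}$$
   Context: For positive integers $p,q$ with $p/q\ge 2$, the fraction graph $E_{p/q}$ has vertex set $\{0,\dots,p-1\}$, and distinct $u,v$ are adjacent iff $u-v \bmod p<q$ or $v-u\bmod p<q$. $\alpha$ is the independence number and $\boxtimes$ is the strong product: $V(G\boxtimes H)=V(G)\times V(H)$, and distinct $(a,x),(b,y)$ are adjacent iff ($a=b$ or $\{a,b\}\in E(G)$) and ($x=y$ or $\{x,y\}\in E(H)$). For $k\in\mathbb N$, define $\alpha_k:\mathbb Q_{\ge2}^k\to\mathbb N$ by $\alpha_k(p_1/q_1,\dots,p_k/q_k)=\alpha(E_{p_1/q_1}\boxtimes\cdots\boxtimes E_{p_k/q_k})$; this does not depend on the choice of the representations $p_i/q_i$ of the rational numbers. For $u,v\in\mathbb Q_{\ge2}^k$ write $u\le v$ if some permutation of $u$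 is coordinatewise at most $v$, and write $u<v$ if $u\le v$ and $u$ is not a permutation of $v$. A point $v\in\mathbb Q_{\ge2}^k$ is a discontinuity of $\alpha_k$ if for every $u\in\mathbb Q_{\ge2}^k$ with $u<v$ one has $\alpha_k(u)<\alpha_k(v)$. *)

(* Defs.v *)
From mathcomp Require Import all_boot all_order all_algebra.

Set Implicit Arguments.
Unset Strict Implicit.
Unset Printing Implicit Defensive.

Import Order.TTheory GRing.Theory Num.Theory.

Record sgraph := SGraph {
  vertex :> finType;
  adj : rel vertex;
  adj_sym : symmetric adj;
  adj_irrefl : irreflexive adj }.

Arguments SGraph {vertex adj}.

Definition independent (G : sgraph) (A : {set G}) : bool :=
  [forall x in A, forall y in A, ~~ adj x y].

Definition indep_number (G : sgraph) : nat :=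
  \max_(A : {set G} | independent A) #|A|.

Section FractionGraph.
Variables p q : nat.

(* For u, v < p, [(u + (p - v)) %% p] is the residue of the integer u - v
   modulo p; it avoids the truncated subtraction of [nat]. *)
Definition frac_adj : rel 'I_p := fun u v =>
  (u != v) && (((u + (p - v)) %% p < q) || ((v + (p - u)) %% p < q)).

Lemma frac_adj_sym : symmetric frac_adj.
Proof. by move=> u v; rewrite /frac_adj eq_sym orbC. Qed.

Lemma frac_adj_irrefl : irreflexive frac_adj.
Proof. by move=> u; rewrite /frac_adj eqxx. Qed.

Definition frac_graph : sgraph := SGraph frac_adj_sym frac_adj_irrefl.
End FractionGraph.

Section StrongProduct.
Variables G H : sgraph.

Definition strong_adj : rel (G * H)%type := fun a b =>
  [&& a != b, (a.1 == b.1) || adj a.1 b.1 & (a.2 == b.2) || adj a.2 b.2].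

Lemma strong_adj_sym : symmetric strong_adj.
Proof.
move=> a b; rewrite /strong_adj eq_sym [a.1 == _]eq_sym [a.2 == _]eq_sym.
by rewrite [adj a.1 _]adj_sym [adj a.2 _]adj_sym.
Qed.

Lemma strong_adj_irrefl : irreflexive strong_adj.
Proof. by move=> a; rewrite /strong_adj eqxx. Qed.

Definition strong_prod : sgraph := SGraph strong_adj_sym strong_adj_irrefl.
End StrongProduct.

Lemma false_sym (T : Type) : symmetric (fun _ _ : T => false).
Proof. by []. Qed.

Lemma false_irrefl (T : Type) : irreflexive (fun _ _ : T => false).
Proof. by []. Qed.

(* The one-vertex graph is the unit of the strong product. *)
Definition graph1 : sgraph := SGraph (@false_sym unit) (@false_irrefl unit).

Local Open Scope ring_scope.

(* The representation p/q of a rational number x >= 2 used here is the one in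
   lowest terms; [numq x] and [denq x] are then positive integers. *)
Definition rat_graph (x : rat) : sgraph := frac_graph `|numq x|%N `|denq x|%N.

Definition alpha (k : nat) (v : k.-tuple rat) : nat :=
  indep_number (foldr strong_prod graph1 [seq rat_graph x | x <- v]).

Definition ge2 (k : nat) (v : k.-tuple rat) : Prop :=
  forall i : 'I_k, 2 <= tnth v i.

Definition perm_le (k : nat) (u v : k.-tuple rat) : Prop :=
  exists2 w : k.-tuple rat, perm_eq w u & forall i : 'I_k, tnth w i <= tnth v i.

Definition perm_lt (k : nat) (u v : k.-tuple rat) : Prop :=
  perm_le u v /\ ~~ perm_eq u v.

Definition discontinuity (k : nat) (v : k.-tuple rat) : Prop :=
  ge2 v /\
  forall u : k.-tuple rat, ge2 u -> perm_lt u v -> (alpha u < alpha v)%N.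

Definition twelve_points : seq (3.-tuple rat * nat) :=
  [:: ([tuple 2; 2; 2], 8%N);
      ([tuple 2; 2; 3], 12%N);
      ([tuple 2; 3; 3], 18%N);
      ([tuple 2; 5 / 2; 5 / 2], 10%N);
      ([tuple 5 / 2; 5 / 2; 3], 15%N);
      ([tuple 9 / 4; 7 / 3; 5 / 2], 9%N);
      ([tuple 5 / 2; 5 / 2; 8 / 3], 11%N);
      ([tuple 8 / 3; 8 / 3; 8 / 3], 12%N);
      ([tuple 11 / 5; 11 / 4; 11 / 4], 11%N);
      ([tuple 11 / 4; 11 / 4; 11 / 4], 13%N);
      ([tuple 14 / 5; 14 / 5; 14 / 5], 14%N);
      ([tuple 3; 3; 3], 27%N)].

(* Main.v *)
Require Import Defs.
From mathcomp Require Import all_boot all_order all_algebra all_fingroup zify lra.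

(** Give each point of an independent set of the strong product its three
    coordinates, and record in which coordinates two points lie far apart.  An
    independent set of size n thus is a covering of all pairs of n points by three
    graphs, the i-th of which has a circular (p_i/q_i)-colouring
    ([alpha_packing]).  In this form alpha_3 is visibly symmetric and monotone,
    and each fraction only enters through the graphs on n vertices that it
    colours.

    Everything follows from one fact ([classification]): below every point
    x <= y <= z of [2,3] there lies a listed point whose value is at least
    alpha_3(x,y,z).  Along the list, going strictly down strictly decreases the
    value ([dominates_strict]), and each listed value is reached by an explicit
    packing ([alpha_ge_values]).  Hence the listed values are exact, the listed
    points are discontinuities, and no other point of the cube is one: a listed
    point below it already has the same value.

    The upper bounds in [classification] are of two kinds.  Most come from
    averaging.  Any q cyclically consecutive residues mod p form a clique of
    E_{p/q}, so the points with first coordinate in such a window are separated by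
    the other two coordinates alone; if there are at most M of them for each
    window, then summing over all windows gives q N <= p M
    ([averaging_bound]).

    Five bounds need more, for instance alpha_3 <= 12 for x < 11/4 and y, z < 3.
    Such a region has no largest point, but a circular (p/q)-colouring of n vertices
    with p > n misses a colour, and the complement of E_{p/q} minus a vertex maps
    to the complement of E_{p'/q'} for the Farey predecessor p'/q' of p/q; so
    numerators at most n suffice ([circ_reduce]).  This leaves a single instance for each bound, here 13 points
    with the fractions 8/3, 11/4, 11/4.  In these instances averaging is nearly
    tight, so up to rotation there are only a few possibilities for the numbers of
    points in the slices of the first coordinate.  Two points in a common window must be separated by
    the second or the third coordinate; labelling such pairs accordingly gives
    two triangle-free graphs, since both fractions are below 3.  There are few such
    labellings, and in each of them one of the two graphs does not have the
    required circular colouring ([refuted]). *)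

Set Implicit Arguments.
Unset Strict Implicit.
Unset Printing Implicit Defensive.

Import Order.TTheory GRing.Theory Num.Theory.

(** * Circular colourings *)

(** Nonadjacency of distinct vertices of E_{p/q}, for u, v < p: both arcs between u
    and v have length at least q. *)
Definition far (p q u v : nat) : bool := q <= (u - v) + (v - u) <= p - q.

Lemma far_sym p q u v : far p q u v = far p q v u.
Proof. by rewrite /far addnC. Qed.

Lemma modn_shift p u s : u < p -> s < p ->
  (u + s) %% p = if u + s < p then u + s else u + s - p.
Proof.
move=> up sp; case: ltnP => h; first by rewrite modn_small.
by rewrite -{1}(subnK h) modnDr modn_small //; lia.
Qed.

Lemma far_shift p q u v s : u < p -> v < p ->
  far p q ((u + s) %% p) ((v + s) %% p) = far p q u v.
Proof.
move=> up vp; have p0 : 0 < p by lia.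
rewrite -[(u + s) %% p]modnDmr -[(v + s) %% p]modnDmr.
have sp : s %% p < p by rewrite ltn_pmod.
rewrite !modn_shift //; move: (s %% p) sp => t tp.
case: (ltnP (u + t) p) => h1; case: (ltnP (v + t) p) => h2; rewrite /far; lia.
Qed.

Lemma far_frac_adj p q (u v : 'I_p) : 0 < q ->
  far p q u v = ~~ ((u == v) || frac_adj q u v).
Proof.
move=> q0; rewrite /frac_adj /far; case: eqVneq => [->|uv] /=; first by rewrite subnn; lia.
have {}uv : (u : nat) <> v by move=> h; case/eqP: uv; apply: val_inj.
have [up vp] := (ltn_ord u, ltn_ord v).
have aux (a b : nat) : a < p -> b < p -> a <> b ->
    (a + (p - b)) %% p = if a < b then p - (b - a) else a - b.
  move=> ap bp ab; case: ltnP => h; first by rewrite modn_small; lia.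
  have -> : a + (p - b) = (a - b) + p by lia.
  by rewrite modnDr modn_small; lia.
by rewrite !aux //; try lia; case: (ltngtP u v) => h; lia.
Qed.

(** A homomorphism from the graph e to the complement of E_{p/q}, which is the circular
    complete graph K_{p/q}; here r is the pair (p, q). *)
Definition circ_colourable (r : nat * nat) (T : Type) (e : rel T) : Prop :=
  exists2 f : T -> nat, forall v, f v < r.1
    & forall u v, e u v -> far r.1 r.2 (f u) (f v).

(** Scaling the circle of length p to length p' and rounding down keeps far points far as
    soon as an arc of length q starting at a used colour keeps length q'.  Only the
    forward arcs out of used colours matter, because the other arc between two colours
    is a forward arc as well. *)
Lemma circ_floor p q p' q' (T : Type) (e : rel T) (f : T -> nat) :
  (forall v, f v < p) -> (forall u v, e u v -> far p q (f u) (f v)) ->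
  0 < p' ->
  (forall v, f v * p' %/ p + q' <= (f v + q) * p' %/ p) ->
  circ_colourable (p', q') e.
Proof.
move=> fp fe p'0 step; exists (fun v => f v * p' %/ p) => /= [v|].
  rewrite ltn_divLR; last by have := fp v; lia.
  by rewrite mulnC ltn_pmul2l.
have mono a b : a <= b -> a * p' %/ p <= b * p' %/ p.
  by move=> ab; rewrite leq_div2r // leq_mul2r ab orbT.
have key u v : f u < f v -> far p q (f u) (f v) ->
    far p' q' (f u * p' %/ p) (f v * p' %/ p).
  move=> uv; rewrite /far => h.
  have h1 := mono (f u + q) (f v) ltac:(lia).
  have h2 := mono (f v + q) (f u + p) ltac:(have := fp v; lia).
  have p0 : 0 < p by have := fp v; lia.
  have E : (f u + p) * p' %/ p = f u * p' %/ p + p'.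
    by rewrite mulnDl addnC [p * p']mulnC divnMDl // addnC.
  rewrite E in h2.
  move: (step u) (step v) h1 h2.
  move: (f u * p' %/ p) (f v * p' %/ p) ((f u + q) * p' %/ p)
        ((f v + q) * p' %/ p) => a b c d *.
  lia.
move=> u v /fe fuv; case: (ltngtP (f u) (f v)) => h.
- exact: key.
- by rewrite far_sym; apply: key => //; rewrite far_sym.
- move: fuv (step v); rewrite /far h subnn addn0 leqn0 => /andP[/eqP -> _].
  by rewrite addn0; move: (_ %/ _) => a; lia.
Qed.

Lemma circ_le p q p' q' (T : Type) (e : rel T) :
  0 < p' -> p * q' <= p' * q -> circ_colourable (p, q) e -> circ_colourable (p', q') e.
Proof.
move=> p'0 le [f /= fp fe]; apply: (circ_floor fp fe p'0) => v.
have p0 : 0 < p by have := fp v; lia.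
rewrite addnC -divnMDl // leq_div2r // mulnDl addnC leq_add2l; lia.
Qed.

(** The Farey predecessor of p/q is the p'/q' with p q' - q p' = 1.  Rotate so that the
    missing colour is 0.  Then i p' leaves a positive remainder mod p for each used
    colour i, so adding q p' = p q' - 1 to it still raises the quotient by q'. *)
Lemma circ_remove p q (T : Type) (e : rel T) (f : T -> nat) c :
  0 < q -> q.*2 < p -> coprime p q ->
  (forall v, f v < p) -> (forall u v, e u v -> far p q (f u) (f v)) ->
  c < p -> (forall v, f v <> c) ->
  exists r, [/\ r.1 < p, 0 < r.2, r.2.*2 <= r.1, r.1 * q <= p * r.2 & circ_colourable r e].
Proof.
move=> q0 qp cpq fp fe cp fc; have p0 : 0 < p by lia.
case: (egcdnP q p0) => q' p' bez; rewrite (eqP cpq) muln1 => p'p.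
rewrite (eqP cpq) in bez.
have q'0 : 0 < q' by case: q' bez => //; lia.
have p'2 : q'.*2 <= p'.
  rewrite -(leq_pmul2r q0) -(leq_add2r 1) -bez.
  by apply: (leq_trans (n := q' * q.*2.+1)); [nia|rewrite leq_mul2l qp orbT].
exists (p', q'); split=> //=; first by lia.
pose g v := (f v + (p - c)) %% p.
have gp v : g v < p by rewrite ltn_pmod.
have ge u v : e u v -> far p q (g u) (g v) by move=> uv; rewrite far_shift ?fe.
have g0 v : 0 < g v.
  rewrite lt0n; apply/eqP; rewrite /g; case: (posnP c) => [c0|cpos].
    rewrite c0 subn0 modnDr modn_small // => h.
    by apply: (fc v); rewrite h c0.
  rewrite modn_shift //; last by lia.
  by case: ltnP; have := fp v; have := fc v; lia.
have cop : coprime p p'.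
  apply/eqP/eqP; rewrite -dvdn1 -(dvdn_addr (m := p' * q)) ?dvdn_mulr ?dvdn_gcdr //.
  by rewrite -bez dvdn_mull // dvdn_gcdl.
apply: (circ_floor gp ge) => [|v]; first by lia.
(* The rotated colour g v is not 0, so the remainder absorbs the -1. *)
have rpos : 0 < (g v * p') %% p.
  rewrite lt0n -/(p %| _) Gauss_dvdl //; apply/negP => /(dvdn_leq (g0 v)).
  by have := gp v; lia.
have -> : (g v + q) * p' = (g v * p' %/ p + q') * p + ((g v * p') %% p).-1.
  have := divn_eq (g v * p') p; move: rpos bez.
  move: (g v * p' %% p) (g v * p' %/ p) => r k; move: (g v) => a.
  rewrite mulnDl [(k + q') * p]mulnDl; move: (a * p') (k * p) (q' * p) => A K Q.
  rewrite [q * p']mulnC; lia.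
by rewrite divnMDl // leq_addr.
Qed.

(** Each use of [circ_remove], or a cancellation of p/q, makes the numerator smaller, and
    as long as it exceeds the number of vertices some colour is missing. *)
Lemma circ_reduce (T : finType) (e : rel T) r :
  0 < r.2 -> r.2.*2 <= r.1 -> circ_colourable r e ->
  exists r', [/\ r'.1 <= maxn 2 #|T|, 0 < r'.2, r'.2.*2 <= r'.1,
                 r'.1 * r.2 <= r.1 * r'.2 & circ_colourable r' e].
Proof.
have [n] := ubnP r.1; elim: n r => // n IH [p q] /= pn q0 qp ce.
case: (leqP p (maxn 2 #|T|)) => [small|big]; first by exists (p, q).
suff [r [rp r0 r2 le cr]] : exists r, [/\ r.1 < p, 0 < r.2, r.2.*2 <= r.1,
    r.1 * q <= p * r.2 & circ_colourable r e].
  have [|r' [s1 s2 s3 s4 s5]] := IH r _ r0 r2 cr; first by lia.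
  exists r'; split=> //=; rewrite -(leq_pmul2r r0).
  apply: (leq_trans (n := r.1 * q * r'.2)).
    by rewrite mulnAC [leqRHS]mulnAC leq_mul2r s4 orbT.
  by rewrite [leqRHS]mulnAC leq_mul2r le orbT.
have g0 : 0 < gcdn p q by rewrite gcdn_gt0 q0 orbT.
case: (boolP (coprime p q)) => [cop|ncop].
  case: ce => f /= fp fe.
  have [c cP] : exists c : 'I_p, c \notin [seq Ordinal (fp v) | v : T].
    apply/existsP; rewrite -negb_forall; apply/negP => /forallP sub.
    have := uniq_leq_size (enum_uniq 'I_p) (fun c _ => sub c).
    by rewrite size_enum_ord size_map -cardE leqNgt (leq_ltn_trans _ big) // leq_maxr.
  apply: (circ_remove q0 _ cop fp fe (ltn_ord c)) => [|v fv].
    rewrite ltn_neqAle qp andbT; apply/eqP => pq.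
    move: cop; rewrite -pq -muln2 coprimeMl /coprime gcdnn => /andP[/eqP q1 _]; lia.
  case/negP: cP; apply/imageP; exists v => //.
  exact: val_inj.
have g1 : 1 < gcdn p q by rewrite /coprime in ncop; lia.
have [dp dq] := (divnK (dvdn_gcdl p q), divnK (dvdn_gcdr p q)).
move: dp dq; set a := p %/ _; set b := q %/ _ => dp dq.
have b0 : 0 < b by move: q0; rewrite -dq muln_gt0 => /andP[].
have E : a * q = p * b by rewrite -[in LHS]dq [b * _]mulnC mulnA dp.
have ba : b.*2 <= a by rewrite -(leq_pmul2r g0) dp -doubleMl dq.
(* The fraction is not reduced: cancel the greatest common divisor. *)
exists (a, b); split=> //=; rewrite ?E //.
  by rewrite -dp ltn_Pmulr //; lia.
by apply: circ_le ce => /=; [lia|rewrite E].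
Qed.

(** * Windows and averaging *)

Lemma sum_rotate p j (a : nat -> nat) : 0 < p ->
  \sum_(c < p) a ((c + j) %% p) = \sum_(c < p) a c.
Proof.
move=> p0; elim: j => [|j IH].
  by apply: eq_bigr => c _; rewrite addn0 modn_small.
rewrite -IH; case: p p0 {IH} => // p _.
rewrite [RHS]big_ord_recl [LHS]big_ord_recr [LHS]addnC /=; congr (_ + _).
  by rewrite add0n addnS -addSn; rewrite modnDl.
by apply: eq_bigr => c _; rewrite /bump /= add1n addnS addSn.
Qed.

Section Windows.
Variables (T : finType) (A : {set T}) (f : T -> nat) (p q : nat).
Hypothesis fp : forall v, f v < p.
Hypothesis qp : q <= p.

Definition slice i := [set v in A | f v == i].
Definition window c := [set v in A | (f v + (p - c)) %% p < q].

Lemma card_window c : c < p -> #|window c| = \sum_(j < q) #|slice ((c + j) %% p)|.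
Proof.
move=> cp; rewrite /window; elim: q qp => [|k IH] kp.
  by rewrite big_ord0; apply: eq_card0 => v; rewrite inE ltn0 andbF.
rewrite big_ord_recr /= -IH; last by lia.
rewrite -cardsUI [X in _ = _ + X](_ : _ = 0) ?addn0; last first.
  apply: eq_card0 => v; rewrite !inE; apply/negP.
  case/andP=> /andP[_ lt] /andP[_ /eqP fv]; move: lt.
  rewrite fv modnDml; have -> : c + k + (p - c) = k + p by lia.
  by rewrite modnDr modn_small ?ltnn.
apply: eq_card => v; rewrite !inE -andb_orr ltnS leq_eqVlt orbC; congr (_ && (_ || _)).
apply/eqP/eqP => [<-|->].
  rewrite modnDmr; have -> : c + (f v + (p - c)) = f v + p by lia.
  by rewrite modnDr modn_small.
rewrite modnDml; have -> : c + k + (p - c) = k + p by lia.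
by rewrite modnDr modn_small.
Qed.

Lemma window_not_far c u v :
  c < p -> u \in window c -> v \in window c -> ~~ far p q (f u) (f v).
Proof.
rewrite !inE => cp /andP[_ hu] /andP[_ hv]; rewrite -(far_shift q (p - c)) //.
move: hu hv; rewrite /far; move: (_ %% p) (_ %% p) => i j; lia.
Qed.

Lemma sum_slices : \sum_(i < p) #|slice i| = #|A|.
Proof.
rewrite -sum1_card (partition_big (fun v => Ordinal (fp v)) xpredT) //=.
apply: eq_bigr => i _; rewrite -sum1_card; apply: eq_bigl => v.
by rewrite inE -val_eqE.
Qed.

Lemma sum_windows : \sum_(c < p) #|window c| = q * #|A|.
Proof.
have [p0|p0] := posnP p.
  have A0 : A = set0 by apply/setP => v; have := fp v; rewrite p0.
  by rewrite A0 cards0 muln0 p0 big_ord0.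
rewrite (eq_bigr (fun c : 'I_p => \sum_(j < q) #|slice ((c + j) %% p)|)); last first.
  by move=> c _; exact: card_window.
rewrite exchange_big /= -sum_slices -[q in RHS]card_ord -sum_nat_const.
by apply: eq_bigr => j _; exact: (sum_rotate j (fun i => #|slice i|)).
Qed.

End Windows.

Definition clique (T : finType) (e : rel T) (A : {set T}) : Prop :=
  {in A &, forall u v, u != v -> e u v}.

Definition clique_bound (T : finType) (e : rel T) M : Prop :=
  forall A, clique e A -> #|A| <= M.

Lemma clique_bound0 (T : finType) (e : rel T) :
  e =2 (fun _ _ => false) -> clique_bound e 1.
Proof.
move=> e0 A cA; rewrite leqNgt; apply/negP => /card_gt1P[u [v [uA vA uv]]].
by have := cA u v uA vA uv; rewrite e0.
Qed.

(** Averaging: the e-pairs disappear inside a window of q consecutive colours, so each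
    window meets a clique of the union in a clique of e', and every vertex lies in exactly
    q of the p windows. *)
Lemma clique_boundU (T : finType) (e e' : rel T) r M M' :
  0 < r.2 <= r.1 -> circ_colourable r e -> clique_bound e' M ->
  r.1 * M < r.2 * M'.+1 ->
  clique_bound (fun u v => e u v || e' u v) M'.
Proof.
case: r => p q /= /andP[q0 qp] [f /= fp fe] bM lt A cA.
rewrite leqNgt; apply/negP => big; move: lt; rewrite ltnNge; case/negP.
apply: (leq_trans (n := q * #|A|)); first by rewrite leq_mul2l big orbT.
rewrite -(sum_windows A fp qp) -[p in p * M]card_ord -sum_nat_const.
apply: leq_sum => c _; apply: bM => u v uW vW uv.
have := window_not_far fp qp (ltn_ord c) uW vW.
have [[uA _] [vA _]] := (setIdP uW, setIdP vW).
by case/orP: (cA u v uA vA uv) => // /fe ->.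
Qed.

(** * Independent sets as coverings by circularly coloured graphs *)

Definition packing (T : finType) (r1 r2 r3 : nat * nat) : Prop :=
  exists e1 e2 e3 : rel T,
  [/\ circ_colourable r1 e1, circ_colourable r2 e2, circ_colourable r3 e3 &
    forall u v, u != v -> [|| e1 u v, e2 u v | e3 u v]].

Definition num_den (x : rat) : nat * nat := (`|numq x|, `|denq x|).

Lemma indep_numberP (G : sgraph) n :
  n <= indep_number G <-> exists2 A : {set G}, independent A & n <= #|A|.
Proof.
split=> [|[A indA le]]; last by apply: leq_trans le _; exact: leq_bigmax_cond.
case: n => [_|n nle].
  by exists set0 => //; apply/forallP => u; rewrite inE.
have [/existsP[A /andP[]]|/existsPn none] :=
  boolP [exists A : {set G}, independent A && (n < #|A|)]; first by exists A.
suff : indep_number G <= n by rewrite leqNgt nle.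
by apply/bigmax_leqP => A indA; have := none A; rewrite indA -leqNgt.
Qed.

(** Equal-or-adjacent is the relation that is multiplicative under strong products. *)
Lemma strong_nearE (G H : sgraph) (a b : strong_prod G H) :
  (a == b) || adj a b =
  ((a.1 == b.1) || adj a.1 b.1) && ((a.2 == b.2) || adj a.2 b.2).
Proof. by have [->|ne] := eqVneq a b; rewrite ?eqxx //= /strong_adj ne. Qed.

Lemma alpha_packing n (x y z : rat) :
  n <= alpha [tuple x; y; z] <-> packing 'I_n (num_den x) (num_den y) (num_den z).
Proof.
have q0 (w : rat) : 0 < (num_den w).2 by rewrite absz_gt0 denq_neq0.
rewrite indep_numberP.
pose fr (w : rat) (u v : rat_graph w) := far (num_den w).1 (num_den w).2 u v.
have sadj (a b : foldr strong_prod graph1 [seq rat_graph w | w <- [:: x; y; z]]) :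
    a != b -> adj a b = ~~ [|| fr x a.1 b.1, fr y a.2.1 b.2.1 | fr z a.2.2.1 b.2.2.1].
  move=> ne; rewrite -[adj a b]orFb -(negbTE ne) !strong_nearE.
  have dm (p q r : bool) : [&& p, q & r] = ~~ [|| ~~ p, ~~ q | ~~ r].
    by case: p q r => [] [] [].
  rewrite (_ : (a.2.2.2 == b.2.2.2) || _) ?andbT; last by case: a.2.2.2 b.2.2.2 => [] [].
  by rewrite /fr !far_frac_adj ?q0 //; exact: dm.
split=> [[A indA cardA]|[e1 [e2 [e3 [[f1 b1 c1] [f2 b2 c2] [f3 b3 c3] cover]]]]].
  pose g (i : 'I_n) := enum_val (widen_ord cardA i).
  have gA i : g i \in A by exact: enum_valP.
  have ginj : injective g by move=> i j /enum_val_inj/(congr1 val)/= ?; exact: val_inj.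
  exists (fun i j => fr x (g i).1 (g j).1), (fun i j => fr y (g i).2.1 (g j).2.1),
    (fun i j => fr z (g i).2.2.1 (g j).2.2.1); split.
  - by exists (fun i => (g i).1 : nat).
  - by exists (fun i => (g i).2.1 : nat).
  - by exists (fun i => (g i).2.2.1 : nat).
  move=> i j ij; have := indA => /forallP/(_ (g i))/implyP/(_ (gA i)).
  move=> /forallP/(_ (g j))/implyP/(_ (gA j)).
  by rewrite sadj ?negbK // (inj_eq ginj).
pose g (i : 'I_n) : foldr strong_prod graph1 [seq rat_graph w | w <- [:: x; y; z]] :=
  (Ordinal (b1 i), (Ordinal (b2 i), (Ordinal (b3 i), tt))).
have gfar i j : i != j -> [|| fr x (g i).1 (g j).1, fr y (g i).2.1 (g j).2.1
    | fr z (g i).2.2.1 (g j).2.2.1].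
  move=> ij; have := cover i j ij; rewrite /fr /=.
  by case/or3P => [/c1|/c2|/c3] ->; rewrite ?orbT.
have frirr w (u : rat_graph w) : fr w u u = false.
  by apply/negbTE; rewrite /fr far_frac_adj // negbK eqxx.
have ginj : injective g.
  by move=> i j gij; apply: contraTeq isT => /gfar; rewrite gij !frirr.
exists (g @: [set: 'I_n]); last by rewrite card_imset // cardsT card_ord.
apply/forallP => u; apply/implyP => /imsetP[i _ ->].
apply/forallP => v; apply/implyP => /imsetP[j _ ->].
have [<-|ij] := eqVneq i j; first by rewrite adj_irrefl.
by rewrite sadj ?gfar // (inj_eq ginj).
Qed.

(** * Enumeration of the labellings of a slice layout *)

(** The label of a pair: [None] if the first coordinate separates it, [Some true] or
    [Some false] if the second, respectively the third, has to.  A row holds the labels of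
    a point towards all earlier points, latest first. *)
Definition label_row := seq (option bool).
(** A partial labelling: the points placed so far, latest first, each with its slice and its
    row.  The row of a point is thus aligned with the rest of the list. *)
Definition state := seq (nat * label_row).

Definition has_label (b : bool) (l : option bool) : bool :=
  if l is Some c then (if b then c else ~~ c) else false.

Fixpoint makes_triangle b (v w : label_row) : bool :=
  match v, w with
  | l :: v', m :: w' =>
    if has_label b l then if has_label b m then true else makes_triangle b v' w'
    else makes_triangle b v' w'
  | _, _ => false
  end.

Fixpoint labels_for p q (i : nat) (st : state) : seq label_row :=
  if st is (k, r) :: st' then
    flatten [seq if far p q i k then [:: None :: v] else
                 [seq Some b :: v | b <- [:: true; false] & ~~ makes_triangle b v r]
            | v <- labels_for p q i st']
  else [:: [::]].

Definition rank (l : option bool) := if l is Some b then b.+1 else 0.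

Fixpoint lex_le (v w : label_row) : bool :=
  match v, w with
  | [::], _ => true
  | _ :: _, [::] => false
  | l :: v', m :: w' =>
    if rank l < rank m then true else if rank m < rank l then false else lex_le v' w'
  end.

(** The points of a slice may be listed in any order, so they are required to be sorted by
    their labels towards the points of the earlier slices.  The first j entries of a row
    are skipped because they concern the slice being filled. *)
Definition key_le (j : nat) (st : state) (v : label_row) : bool :=
  if j isn't k.+1 then true
  else if st is (_, r) :: _ then lex_le (drop k r) (drop j v) else true.

Fixpoint degrees b (st : state) : seq nat :=
  if st is (_, r) :: st' then
    count (has_label b) r ::
    [seq (has_label b ld.1 : nat) + ld.2 | ld <- zip r (degrees b st')]
  else [::].

(** Bounds on the degrees of the two label graphs, supplied by averaging, keep the
    enumeration small in the instances with nine points. *)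
Definition degrees_within (cap : bool -> nat) (st : state) : bool :=
  all (fun b => all (leq^~ (cap b)) (degrees b st)) [:: true; false].

Definition add_point p q cap i j (st : state) : seq state :=
  [seq st' <- [seq (i, v) :: st | v <- labels_for p q i st & key_le j st v]
  | degrees_within cap st'].

Definition add_slice p q cap i m (sts : seq state) : seq state :=
  foldl (fun ss j => flatten [seq add_point p q cap i j st | st <- ss]) sts (iota 0 m).

Definition labellings p q cap (a : seq nat) : seq state :=
  foldl (fun ss im => add_slice p q cap im.1 im.2 ss) [:: [::]] (zip (iota 0 (size a)) a).

Fixpoint compatible p q b (c : nat) (v : label_row) (cs : seq nat) : bool :=
  match v, cs with
  | l :: v', d :: cs' =>
    if has_label b l then if far p q c d then compatible p q b c v' cs' else false
    else compatible p q b c v' cs'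
  | _, _ => true
  end.

(** Under call by value [has] evaluates its predicate on the whole list; this version stops
    at the first success, which is what makes the backtracking below a depth-first search. *)
Fixpoint search (T : Type) (a : pred T) (s : seq T) : bool :=
  if s is x :: s' then if a x then true else search a s' else false.

Fixpoint extendable p q b (rows : seq label_row) (cs : seq nat) : bool :=
  if rows is v :: rows' then
    search (fun c => if compatible p q b c v cs then extendable p q b rows' (c :: cs)
                   else false) (iota 0 p)
  else true.

(** Colours are assigned oldest point first.  By rotation the first point gets colour 0. *)
Definition labels_colourable r b (st : state) : bool :=
  if rev [seq kv.2 | kv <- st] is _ :: rows then extendable r.1 r.2 b rows [:: 0]
  else true.

(** The layout a puts [nth 0 a i] points into slice i of the first coordinate.  Every
    labelling kept by the enumeration has a label graph without the circular colouring
    that its coordinate would provide. *)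
Definition refuted r1 r2 r3 cap (a : seq nat) : bool :=
  all (fun st => if labels_colourable r2 true st then ~~ labels_colourable r3 false st
                 else true)
      (labellings r1.1 r1.2 cap a).

Lemma lex_le_total : total lex_le.
Proof.
elim=> [|l v IH] [|m w] //=.
by case: (ltngtP (rank l) (rank m)).
Qed.

Lemma searchE (T : Type) (a : pred T) (s : seq T) : search a s = has a s.
Proof. by elim: s => //= x s ->. Qed.

(** * Completeness of the enumeration *)

Section Soundness.
Variables (T : finType) (p q : nat) (f : T -> nat) (ey : rel T).
Hypothesis ey_sym : symmetric ey.

Definition label (u v : T) : option bool :=
  if far p q (f u) (f v) then None else Some (ey u v).

Lemma label_sym u v : label u v = label v u.
Proof. by rewrite /label far_sym ey_sym. Qed.

Definition row_of v (s : seq T) : label_row := [seq label v u | u <- s].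

Fixpoint encode (s : seq T) : state :=
  if s is v :: s' then (f v, row_of v s') :: encode s' else [::].

Definition edge b (u v : T) : bool := (u != v) && has_label b (label u v).

Lemma edge_sym b u v : edge b u v = edge b v u.
Proof. by rewrite /edge eq_sym label_sym. Qed.

Hypothesis no_triangle : forall b u v w,
  edge b u v -> edge b u w -> edge b v w -> False.

Lemma makes_triangleP b u v s : u \notin s -> v \notin s -> u != v ->
  has_label b (label u v) -> makes_triangle b (row_of u s) (row_of v s) = false.
Proof.
elim: s => //= w s IH; rewrite !inE !negb_or => /andP[uw us] /andP[vw vs] uv luv.
case: ifP => luw; last exact: IH.
case: ifP => lvw; last exact: IH.
by case: (@no_triangle b u v w); rewrite /edge ?uv ?uw ?vw.
Qed.

Lemma labels_forP v s : uniq (v :: s) -> row_of v s \in labels_for p q (f v) (encode s).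
Proof.
elim: s => [|u s IH] //; rewrite /= inE negb_or -andbA => /and4P[vu vs us uniqs].
apply/flatten_mapP; exists (row_of v s); first by apply: IH; rewrite /= vs.
have nc : ~~ far p q (f v) (f u) ->
    makes_triangle (ey v u) (row_of v s) (row_of u s) = false.
  move=> near; apply: makes_triangleP => //.
  by rewrite /label (negbTE near); case: (ey v u).
rewrite {1}/label; case: ifP nc => [_ _|_ /(_ isT)]; first by rewrite inE eqxx.
case: (ey v u) => -> /=; first by rewrite inE eqxx.
by case: ifP => _; rewrite !inE eqxx ?orbT.
Qed.

(** Adding a point updates the degrees of the earlier points by its row, by symmetry of
    labels. *)
Lemma degreesE b s : uniq s ->
  degrees b (encode s) = [seq count (edge b v) s | v <- s].
Proof.
elim: s => //= v s IH /andP[vs us]; rewrite {1}/edge eqxx /= add0n; congr (_ :: _).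
  rewrite count_map; apply: eq_in_count => u us'; rewrite /= /edge.
  by case: eqVneq us' vs => [->|] // ->.
have add_nbrs (F : T -> nat) t : v \notin t ->
    [seq (has_label b ld.1 : nat) + ld.2 | ld <- zip (row_of v t) [seq F w | w <- t]]
    = [seq (edge b w v : nat) + F w | w <- t].
  elim: t => //= w t IHt; rewrite inE negb_or => /andP[vw vt].
  by rewrite IHt // edge_sym /edge vw.
by rewrite (IH us) add_nbrs.
Qed.

Variable cap : bool -> nat.
Hypothesis cap_edge : forall b v, #|[set u | edge b v u]| <= cap b.

Lemma degrees_within_encode s : uniq s -> degrees_within cap (encode s).
Proof.
move=> us; rewrite /degrees_within; apply/allP => b _; rewrite degreesE //.
apply/allP => _ /mapP[v _ ->]; apply: leq_trans (cap_edge b v).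
rewrite -size_filter -(card_uniqP (filter_uniq _ us)).
by apply: subset_leq_card; apply/subsetP => u; rewrite mem_filter inE => /andP[].
Qed.

Definition key_rel pre : rel T := relpre (row_of^~ pre) lex_le.

Lemma uniq_catrev (s t : seq T) : uniq (catrev s t) = uniq (s ++ t).
Proof.
rewrite catrevE !cat_uniq rev_uniq; congr [&& _, ~~ _ & _].
by apply: eq_has => v; rewrite /= mem_rev.
Qed.

Lemma add_point_complete i pre d v st : st = encode (d ++ pre) ->
  uniq (v :: d ++ pre) -> f v = i -> (if d is u :: _ then key_rel pre u v else true) ->
  encode (v :: d ++ pre) \in add_point p q cap i (size d) st.
Proof.
move=> -> uv fv key; rewrite mem_filter degrees_within_encode //=.
apply/mapP; exists (row_of v (d ++ pre)); last by rewrite fv.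
rewrite mem_filter -fv labels_forP // andbT.
case: d key {uv} => // u d /= key.
by rewrite /row_of -!map_drop !drop_size_cat.
Qed.

Lemma add_slice_complete i pre (s : seq T) sts :
  uniq (s ++ pre) -> {in s, forall v, f v = i} -> sorted (key_rel pre) s ->
  encode pre \in sts -> encode (catrev s pre) \in add_slice p q cap i (size s) sts.
Proof.
rewrite -uniq_catrev => us fs sorted_s inst; rewrite /add_slice.
suff gen (d : seq T) ss : uniq (catrev s (d ++ pre)) ->
    (if d is u :: _ then path (key_rel pre) u s else sorted (key_rel pre) s) ->
    encode (d ++ pre) \in ss ->
    encode (catrev s (d ++ pre)) \in
      foldl (fun ss j => flatten [seq add_point p q cap i j st | st <- ss]) ss
        (iota (size d) (size s)) by exact: (gen [::]).
elim: s fs d ss {us sorted_s inst} => // v s IH fs d ss us key inss.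
apply: (IH _ (v :: d)) => //.
- by move=> u us'; apply: fs; rewrite inE us' orbT.
- by case: d us key inss => [|u d] us // /andP[].
apply/flatten_mapP; exists (encode (d ++ pre)) => //.
apply: add_point_complete => //.
- by move: us; rewrite /= uniq_catrev cat_uniq => /and3P[].
- by apply: fs; rewrite inE eqxx.
- by case: d us key inss => [|u d] us // /andP[].
Qed.

(** Sorting each slice by [key_rel] produces an ordering of all points that the
    enumeration goes through. *)
Lemma labellings_complete a : (forall v, f v < size a) ->
  (forall i, i < size a -> #|[set v | f v == i]| = nth 0 a i) ->
  exists2 s : seq T, perm_eq s (enum T) & encode s \in labellings p q cap a.
Proof.
move=> fa cnt; rewrite /labellings.
suff gen k b pre ss : size a = k + size b -> drop k a = b -> uniq pre ->
    (forall v, (v \in pre) = (f v < k)) -> encode pre \in ss ->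
    exists2 s, perm_eq s (enum T) & encode s \in
      foldl (fun ss im => add_slice p q cap im.1 im.2 ss) ss (zip (iota k (size b)) b).
  by apply: (gen 0 a [::] [:: [::]]) => //; rewrite drop0.
elim: b k pre ss => [|m b IH] k pre ss sz dr up mempre inss.
  exists pre => //; apply: uniq_perm (enum_uniq _) _ => // v.
  by rewrite mempre mem_enum -[k]addn0 -sz fa.
pose s := sort (key_rel pre) (enum [set v | f v == k]).
have mems v : (v \in s) = (f v == k) by rewrite mem_sort mem_enum inE.
have ka : k < size a by rewrite sz /=; lia.
have ms : m = size s.
  by rewrite size_sort -cardE cnt // -[m]/(nth 0 (m :: b) 0) -dr nth_drop addn0.
have us : uniq (s ++ pre).
  rewrite cat_uniq sort_uniq enum_uniq up andbT /=; apply/hasPn => v.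
  by rewrite mempre /= mems; lia.
apply: (IH k.+1 (catrev s pre)) => //.
- by rewrite sz /=; lia.
- by rewrite -addn1 addnC -drop_drop dr /= drop0.
- by rewrite uniq_catrev.
- by move=> v; rewrite catrevE mem_cat mem_rev mems mempre; lia.
rewrite ms; apply: add_slice_complete => //.
- by move=> v; rewrite mems => /eqP.
- by apply: sort_sorted => u v; exact: lex_le_total.
Qed.

Lemma compatibleP b r c v s (g : T -> nat) :
  (forall u, edge b v u -> far r.1 r.2 c (g u)) -> v \notin s ->
  compatible r.1 r.2 b c (row_of v s) [seq g u | u <- s].
Proof.
move=> fe; elim: s => //= u s IH; rewrite inE negb_or => /andP[vu vs].
case: ifP => luv; last exact: IH.
by rewrite fe ?IH // /edge vu.
Qed.

Fixpoint rows_over (s t : seq T) : seq label_row :=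
  if t is v :: t' then row_of v s :: rows_over (v :: s) t' else [::].

Lemma rev_rows s t : rev [seq kv.2 | kv <- encode (catrev t s)] =
  rev [seq kv.2 | kv <- encode s] ++ rows_over s t.
Proof.
elim: t s => [|v t IH] s /=; first by rewrite cats0.
by rewrite IH /= rev_cons cat_rcons.
Qed.

Lemma labels_colourableP b r s :
  uniq s -> circ_colourable r (edge b) -> labels_colourable r b (encode s).
Proof.
move=> us [g0 gr ge]; rewrite /labels_colourable.
have -> : s = catrev (rev s) [::] by rewrite catrevE revK cats0.
rewrite rev_rows /=; have : uniq (rev s) by rewrite rev_uniq.
case: (rev s) => [//|v0 t] /= /andP[v0t ut].
have r0 : 0 < r.1 by have := gr v0; lia.
pose g v := (g0 v + (r.1 - g0 v0)) %% r.1.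
have gE u v : edge b u v -> far r.1 r.2 (g u) (g v) by move=> uv; rewrite far_shift ?ge.
(* Rotating by the colour of the first point makes it 0. *)
have -> : [:: 0] = [seq g v | v <- [:: v0]].
  by rewrite /= /g subnKC ?modnn // ltnW.
have : uniq (catrev t [:: v0]) by rewrite uniq_catrev cats1 rcons_uniq v0t.
elim: t [:: v0] {v0t ut} => //= v t IH s' us'.
rewrite searchE; apply/hasP; exists (g v).
  by rewrite mem_iota add0n ltn_pmod.
rewrite compatibleP ?(IH (v :: s')) //; first by move=> u; exact: gE.
by move: us'; rewrite uniq_catrev cat_uniq => /and3P[_ _ /= /andP[]].
Qed.

Lemma not_refuted r2 r3 a : (forall v, f v < size a) ->
  (forall i, i < size a -> #|[set v | f v == i]| = nth 0 a i) ->
  circ_colourable r2 (edge true) -> circ_colourable r3 (edge false) ->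
  ~~ refuted (p, q) r2 r3 cap a.
Proof.
move=> fa cnt c2 c3; have [s ps sl] := labellings_complete fa cnt.
have us : uniq s by rewrite (perm_uniq ps) enum_uniq.
by apply/allPn; exists (encode s) => //; rewrite !labels_colourableP.
Qed.

End Soundness.

(** * Profiles of a nearly tight packing *)

(** Candidates for the tail of a profile, built from the right; a window is tested as
    soon as it is complete, which keeps the list short. *)
Fixpoint window_seqs q lo M k : seq (seq nat) :=
  if k is k'.+1 then
    [seq x :: b | b <- window_seqs q lo M k',
      x <- [seq x <- iota 0 M.+1 |
             (size b < q.-1) || (lo <= x + sumn (take q.-1 b) <= M)]]
  else [:: [::]].

Definition is_profile q lo M N (a : seq nat) : bool :=
  (sumn a == N) && all (fun c => lo <= sumn (take q (rot c a)) <= M) (iota 0 (size a)).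

Definition profiles_among p q lo M N (ts : seq (seq nat)) : bool :=
  all (fun a => is_profile q lo M N a ==> has (fun c => rot c a \in ts) (iota 0 p))
      (window_seqs q lo M p).

Lemma rot_mkseq c p (a : nat -> nat) : c < p ->
  rot c (mkseq a p) = mkseq (fun i => a ((c + i) %% p)) p.
Proof.
move=> cp; apply: (@eq_from_nth _ 0); rewrite size_rot !size_mkseq // => i ip.
rewrite nth_mkseq // /rot nth_cat size_drop size_mkseq nth_drop.
case: ltnP => h; first by rewrite nth_mkseq ?modn_small //; lia.
rewrite nth_take; last by lia.
rewrite nth_mkseq; last by lia.
by congr a; rewrite addnC modn_shift //; case: ltnP; lia.
Qed.

Lemma sumn_mkseq n (a : nat -> nat) : sumn (mkseq a n) = \sum_(i < n) a i.
Proof. by rewrite sumnE big_map -[n in iota 0 n]subn0 -/(index_iota 0 n) big_mkord. Qed.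

Lemma window_seqsP p q lo M N a : 0 < q <= p -> size a = p ->
  is_profile q lo M N a -> a \in window_seqs q lo M p.
Proof.
move=> /andP[q0 qp] sz /andP[_ /allP win].
have {}win c : c < p -> lo <= sumn (take q (rot c a)) <= M.
  by move=> cp; apply: win; rewrite mem_iota sz.
suff gen k : k <= p -> drop (p - k) a \in window_seqs q lo M k.
  by have := gen p (leqnn p); rewrite subnn drop0.
elim: k => [|k IH] kp; first by rewrite subn0 -sz drop_size.
have ck : p - k.+1 < p by lia.
have -> : drop (p - k.+1) a = nth 0 a (p - k.+1) :: drop (p - k) a.
  by rewrite (drop_nth 0) ?sz //; congr (_ :: drop _ _); lia.
have szd : size (drop (p - k) a) = k by rewrite size_drop sz; lia.
apply/allpairsPdep; exists (drop (p - k) a), (nth 0 a (p - k.+1)); split=> //.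
  by apply: IH; lia.
have E : rot (p - k.+1) a = nth 0 a (p - k.+1) :: (drop (p - k) a ++ take (p - k.+1) a).
  by rewrite /rot (drop_nth 0) ?sz // cat_cons; congr (_ :: drop _ _ ++ _); lia.
rewrite mem_filter mem_iota add0n ltnS szd.
have := win _ ck; rewrite E; case: (q) q0 qp => // q' _ qp' /=.
move=> /andP[lw wM]; rewrite (leq_trans (leq_addr _ _) wM) andbT.
case: ltnP => //= le; rewrite take_cat szd in lw wM.
move: lw wM; case: ltngtP le => // [lt|qk] _ lw wM; first by rewrite lw.
by rewrite qk subnn take0 cats0 in lw wM; rewrite qk take_oversize ?szd ?lw.
Qed.

(** Three pairwise far points cut the circle into three arcs of length at least q. *)
Lemma far_triangle p q u v w : p < 3 * q ->
  far p q u v -> far p q u w -> far p q v w -> False.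
Proof. rewrite /far; lia. Qed.

Definition covering (T : finType) (r1 r2 r3 : nat * nat) (f1 f2 f3 : T -> nat) : Prop :=
  [/\ forall v, f1 v < r1.1, forall v, f2 v < r2.1, forall v, f3 v < r3.1 &
      forall u v, u != v -> [|| far r1.1 r1.2 (f1 u) (f1 v),
        far r2.1 r2.2 (f2 u) (f2 v) | far r3.1 r3.2 (f3 u) (f3 v)]].

Lemma packing_covering (T : finType) r1 r2 r3 : packing T r1 r2 r3 ->
  exists f1 f2 f3 : T -> nat, covering r1 r2 r3 f1 f2 f3.
Proof.
case=> [e1 [e2 [e3 [[f1 b1 c1] [f2 b2 c2] [f3 b3 c3] cov]]]].
exists f1, f2, f3; split=> // u v /cov.
by case/or3P => [/c1|/c2|/c3] ->; rewrite ?orbT.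
Qed.

(** Averaging over the third coordinate, with at most two points per window because the
    second fraction is below 3, allows at most M points separated by these two coordinates. *)
Definition plane_bound (r2 r3 : nat * nat) M :=
  [&& 0 < r2.2 <= r2.1, 0 < r3.2 <= r3.1, r2.1 < 3 * r2.2 & r3.1 * 2 < r3.2 * M.+1].

Lemma card_window_le (T : finType) r1 r2 r3 (f1 f2 f3 : T -> nat) M c :
  0 < r1.2 <= r1.1 -> plane_bound r2 r3 M -> covering r1 r2 r3 f1 f2 f3 ->
  c < r1.1 -> #|window [set: T] f1 r1.1 r1.2 c| <= M.
Proof.
move=> /andP[q1 qp1] /and4P[g2 g3 lt2 lt3] [b1 b2 b3 cov] cr.
pose e r g : rel T := fun u v => far r.1 r.2 (g u) (g v).
have ce r (g : T -> nat) : (forall v, g v < r.1) -> circ_colourable r (e r g).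
  by move=> bg; exists g.
have bd2 : clique_bound (fun u v => e r2 f2 u v || false) 2.
  apply: (clique_boundU (M := 1) g2 (ce r2 f2 b2)); last by lia.
  exact: clique_bound0.
have bd : clique_bound (fun u v => e r3 f3 u v || (e r2 f2 u v || false)) M.
  exact: (clique_boundU g3 (ce r3 f3 b3) bd2).
apply: bd => u v uW vW uv; rewrite /e orbF orbC.
by move: (cov u v uv); rewrite (negbTE (window_not_far b1 qp1 cr uW vW)).
Qed.

(** The windows hold q N points in total and at most M each, so each of them holds at
    least lo points; this pins the profile of the first coordinate down to ts.  After a
    rotation the layout is in ts, and labelling a pair by the second coordinate whenever
    that separates it defeats the refutation. *)
Lemma covering_not_refuted (T : finType) r1 r2 r3 (f1 f2 f3 : T -> nat) cap M lo ts :
  0 < r1.2 <= r1.1 -> plane_bound r2 r3 M -> r3.1 < 3 * r3.2 ->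
  lo + r1.1.-1 * M <= r1.2 * #|T| ->
  covering r1 r2 r3 f1 f2 f3 ->
  (forall v, #|[set u | far r2.1 r2.2 (f2 v) (f2 u)]| <= cap true) ->
  (forall v, #|[set u | far r3.1 r3.2 (f3 v) (f3 u)]| <= cap false) ->
  profiles_among r1.1 r1.2 lo M #|T| ts ->
  ~~ all (refuted r1 r2 r3 cap) ts.
Proof.
case: r1 => p q /= qq num lt3 los cv cap2 cap3 among.
have /andP[q0 qp] := qq.
have winM c : c < p -> #|window [set: T] f1 p q c| <= M.
  exact: (@card_window_le T (p, q) r2 r3 f1 f2 f3 M c qq num cv).
case: cv => /= b1 b2 b3 cov.
have winlo c : c < p -> lo <= #|window [set: T] f1 p q c|.
  move=> cp; rewrite -(leq_add2r (p.-1 * M)); apply: leq_trans los _.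
  rewrite -cardsT -(sum_windows [set: T] b1 qp) (bigD1 (Ordinal cp)) //= leq_add2l.
  have -> : p.-1 = #|[pred c' : 'I_p | c' != Ordinal cp]|.
    by rewrite -[in LHS](card_ord p) (cardC1 (Ordinal cp)).
  by rewrite -sum_nat_const; apply: leq_sum => c' _; apply: winM.
pose a := mkseq (fun i => #|slice [set: T] f1 i|) p.
have prof : is_profile q lo M #|T| a.
  rewrite /is_profile sumn_mkseq sum_slices // cardsT eqxx /=.
  apply/allP => c; rewrite mem_iota size_mkseq add0n => cp.
  have -> : sumn (take q (rot c a)) = #|window [set: T] f1 p q c|.
    rewrite card_window // rot_mkseq // /mkseq -map_take take_iota (minn_idPl qp).
    exact: sumn_mkseq.
  by rewrite winlo ?winM.
have sza : size a = p by rewrite size_mkseq.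
have /allP/(_ a (window_seqsP qq sza prof))/implyP/(_ prof)/hasP[c] := among.
rewrite mem_iota add0n => /= cp tin; apply/allPn; exists (rot c a) => //.
(* Subtracting c from the first coordinate rotates its profile by c. *)
pose f v := (f1 v + (p - c)) %% p.
pose ey : rel T := fun u v => far r2.1 r2.2 (f2 u) (f2 v).
have fbd v : f v < p by rewrite ltn_pmod //; lia.
have edge2 u v : edge p q f ey true u v -> far r2.1 r2.2 (f2 u) (f2 v).
  by rewrite /edge /label; case: ifP => //= _; rewrite ?andbF // => /andP[].
have edge3 u v : edge p q f ey false u v -> far r3.1 r3.2 (f3 u) (f3 v).
  rewrite /edge /label far_shift //.
  case: ifP => //= [|n1]; rewrite ?andbF // => /andP[uv n2].
  by have := cov u v uv; rewrite n1 -/(ey u v) (negbTE n2).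
apply: (@not_refuted T p q f ey).
- by move=> u v; rewrite /ey far_sym.
- move=> [] u v w; last first.
    by move=> /edge3 h1 /edge3 h2 /edge3 h3; apply: (far_triangle lt3 h1 h2 h3).
  move=> /edge2 h1 /edge2 h2 /edge2 h3; apply: (far_triangle _ h1 h2 h3).
  by case/and4P: num.
- move=> [] v; [apply: leq_trans (cap2 v)|apply: leq_trans (cap3 v)];
    apply: subset_leq_card; apply/subsetP => u; rewrite !inE.
  + exact: edge2.
  + exact: edge3.
- by move=> v; rewrite size_rot sza.
- move=> i; rewrite size_rot sza rot_mkseq // => ip; rewrite nth_mkseq //.
  apply: eq_card => v; rewrite !inE /f; apply/eqP/eqP => [<-|->].
    rewrite modnDmr; have -> : c + (f1 v + (p - c)) = f1 v + p by lia.
    by rewrite modnDr modn_small.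
  rewrite modnDml; have -> : c + i + (p - c) = i + p by lia.
  by rewrite modnDr modn_small.
- by exists f2.
- by exists f3.
Qed.

(** With p = 2q + 1, the complement of a slice splits into two windows, so every slice has
    at least N - 2M points.  The points far from v occupy two adjacent slices, and a window
    containing these two contains k further slices. *)
Lemma odd_degree (T : finType) (f : T -> nat) k M v :
  let q := 2 + k in let p := 1 + (q + q) in
  (forall v, f v < p) -> (forall c, c < p -> #|window [set: T] f p q c| <= M) ->
  #|[set u | far p q (f v) (f u)]| + k * (#|T| - 2 * M) <= M.
Proof.
move=> q p fp win; have p0 : 0 < p by []; have qp : q <= p by lia.
pose a i := #|slice [set: T] f i|.
have winE c : \sum_(j < q) a ((c + j) %% p) = #|window [set: T] f p q (c %% p)|.
  rewrite card_window ?ltn_pmod //; apply: eq_bigr => j _; by rewrite modnDml.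
(* The p slices from slice i on are slice i and two windows. *)
have lo i : #|T| - 2 * M <= a (i %% p).
  have : \sum_(j < p) a ((j + i) %% p) = #|T| by rewrite sum_rotate // sum_slices // cardsT.
  rewrite big_split_ord big_split_ord big_ord1 /= add0n => <-.
  have := win _ (ltn_pmod (i + 1) p0); have := win _ (ltn_pmod (i + 1 + q) p0).
  rewrite -!winE => w1 w2.
  rewrite leq_subLR addnC leq_add2r mul2n -addnn.
  apply: leq_add.
    apply: leq_trans w2; apply: eq_leq; apply: eq_bigr => j _.
    by congr (a (_ %% p)); lia.
  apply: leq_trans w1; apply: eq_leq; apply: eq_bigr => j _.
  by congr (a (_ %% p)); lia.
pose c := f v + q.
have far_slices : [set u | far p q (f v) (f u)] \subset
    slice [set: T] f (c %% p) :|: slice [set: T] f ((c + 1) %% p).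
  apply/subsetP => u; rewrite !inE /= /c -addnA !modn_shift //; try lia.
  have := fp u; have := fp v; rewrite /far.
  by do 2 case: ifP; lia.
apply: leq_trans (win _ (ltn_pmod c p0)); rewrite -winE big_split_ord; apply: leq_add.
  apply: leq_trans (subset_leq_card far_slices) _; apply: leq_trans (leq_card_setU _ _) _.
  by rewrite big_ord_recl big_ord1 /= addn0.
rewrite -[k in k * _]card_ord -sum_nat_const; apply: leq_sum => j _; exact: lo.
Qed.

Lemma covering_swap12 (T : finType) r1 r2 r3 (f1 f2 f3 : T -> nat) :
  covering r1 r2 r3 f1 f2 f3 -> covering r2 r1 r3 f2 f1 f3.
Proof. by case=> b1 b2 b3 cov; split=> // u v /cov; rewrite orbCA. Qed.

Lemma covering_swap13 (T : finType) r1 r2 r3 (f1 f2 f3 : T -> nat) :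
  covering r1 r2 r3 f1 f2 f3 -> covering r3 r2 r1 f3 f2 f1.
Proof.
by case=> b1 b2 b3 cov; split=> // u v /cov; case/or3P => ->; rewrite ?orbT.
Qed.

(** * The five finite instances *)

(** Here 3 * 13 = 8 * 5 - 1: all but one of the eight windows are full. *)
Definition profiles13 : seq (seq nat) :=
  [:: [:: 1; 2; 2; 1; 2; 2; 1; 2]].

Lemma profiles13P : profiles_among 8 3 4 5 13 profiles13.
Proof. by vm_compute. Qed.

Lemma refuted13 : all (refuted (8, 3) (11, 4) (11, 4) (fun _ => 13)) profiles13.
Proof. by vm_compute. Qed.

Lemma no_packing13 (T : finType) : #|T| = 13 -> ~ packing T (8, 3) (11, 4) (11, 4).
Proof.
move=> cT /packing_covering[f1 [f2 [f3 cov]]]; suff : ~~ true by [].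
rewrite -[true]refuted13; apply: (@covering_not_refuted T _ _ _ f1 f2 f3 _ 5 4) => //.
- by rewrite cT.
- by move=> v; rewrite -cT max_card.
- by move=> v; rewrite -cT max_card.
- by rewrite cT; exact: profiles13P.
Qed.

(** Here 2 * 12 = 5 * 5 - 1: all but one of the five windows are full. *)
Definition profiles12 : seq (seq nat) :=
  [:: [:: 2; 3; 2; 3; 2]].

Lemma profiles12P : profiles_among 5 2 4 5 12 profiles12.
Proof. by vm_compute. Qed.

Lemma refuted12 : all (refuted (5, 2) (11, 4) (11, 4) (fun _ => 12)) profiles12.
Proof. by vm_compute. Qed.

Lemma no_packing12 (T : finType) : #|T| = 12 -> ~ packing T (5, 2) (11, 4) (11, 4).
Proof.
move=> cT /packing_covering[f1 [f2 [f3 cov]]]; suff : ~~ true by [].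
rewrite -[true]refuted12; apply: (@covering_not_refuted T _ _ _ f1 f2 f3 _ 5 4) => //.
- by rewrite cT.
- by move=> v; rewrite -cT max_card.
- by move=> v; rewrite -cT max_card.
- by rewrite cT; exact: profiles12P.
Qed.

(** Here 2 * 11 = 5 * 5 - 3 leaves room for several profiles.  The rotation listed for each
    is one for which the enumeration is short. *)
Definition profiles11 : seq (seq nat) :=
  [:: [:: 1; 1; 4; 1; 4]; [:: 2; 3; 1; 4; 1]; [:: 1; 4; 1; 3; 2];
  [:: 2; 3; 2; 3; 1]; [:: 1; 3; 2; 3; 2]; [:: 1; 3; 2; 2; 3]; [:: 2; 3; 2; 2; 2]].

Lemma profiles11P : profiles_among 5 2 2 5 11 profiles11.
Proof. by vm_compute. Qed.

Lemma refuted11 : all (refuted (5, 2) (5, 2) (5, 2) (fun _ => 11)) profiles11.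
Proof. by vm_compute. Qed.

Lemma no_packing11 (T : finType) : #|T| = 11 -> ~ packing T (5, 2) (5, 2) (5, 2).
Proof.
move=> cT /packing_covering[f1 [f2 [f3 cov]]]; suff : ~~ true by [].
rewrite -[true]refuted11; apply: (@covering_not_refuted T _ _ _ f1 f2 f3 _ 5 2) => //.
- by rewrite cT.
- by move=> v; rewrite -cT max_card.
- by move=> v; rewrite -cT max_card.
- by rewrite cT; exact: profiles11P.
Qed.

(** Here 3 * 9 = 7 * 4 - 1: all but one of the seven windows are full. *)
Definition profiles9_all_small : seq (seq nat) :=
  [:: [:: 1; 1; 2; 1; 1; 2; 1]].

Lemma profiles9_all_smallP : profiles_among 7 3 3 4 9 profiles9_all_small.
Proof. by vm_compute. Qed.

Lemma refuted9_all_small :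
  all (refuted (7, 3) (7, 3) (7, 3) (fun _ => 3)) profiles9_all_small.
Proof. by vm_compute. Qed.

Lemma degree_all_small (T : finType) r2 r3 (f1 f2 f3 : T -> nat) v :
  #|T| = 9 -> plane_bound r2 r3 4 -> covering (7, 3) r2 r3 f1 f2 f3 ->
  #|[set u | far 7 3 (f1 v) (f1 u)]| <= 3.
Proof.
move=> cT num cov; have [b1 _ _ _] := cov.
have := @odd_degree T f1 1 4 v b1; rewrite cT => deg.
suff : #|[set u | far 7 3 (f1 v) (f1 u)]| + 1 <= 4 by rewrite addn1.
by apply: deg => c cp; exact: (@card_window_le T (7, 3) r2 r3 f1 f2 f3 4 c isT num cov cp).
Qed.

Lemma no_packing9_all_small (T : finType) : #|T| = 9 -> ~ packing T (7, 3) (7, 3) (7, 3).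
Proof.
move=> cT /packing_covering[f1 [f2 [f3 cov]]]; suff : ~~ true by [].
rewrite -[true]refuted9_all_small.
apply: (@covering_not_refuted T _ _ _ f1 f2 f3 _ 4 3) => //.
- by rewrite cT.
- move=> v; exact: (@degree_all_small T (7, 3) (7, 3) f2 f1 f3 v cT isT (covering_swap12 cov)).
- move=> v; exact: (@degree_all_small T (7, 3) (7, 3) f3 f2 f1 v cT isT (covering_swap13 cov)).
- by rewrite cT; exact: profiles9_all_smallP.
Qed.

(** Here 4 * 9 = 9 * 4: every window is full, so each slice is a single point.  The
    fraction 8/3 comes second, since [plane_bound] averages over the third coordinate and
    9/4 * 2 < 5 while 8/3 * 2 > 5. *)
Definition profiles9_two_small : seq (seq nat) :=
  [:: nseq 9 1].

Lemma profiles9_two_smallP : profiles_among 9 4 4 4 9 profiles9_two_small.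
Proof. by vm_compute. Qed.

Lemma refuted9_two_small :
  all (refuted (9, 4) (8, 3) (9, 4) (fun b : bool => if b then 9 else 2))
    profiles9_two_small.
Proof. by vm_compute. Qed.

Lemma no_packing9_two_small (T : finType) : #|T| = 9 -> ~ packing T (9, 4) (8, 3) (9, 4).
Proof.
move=> cT /packing_covering[f1 [f2 [f3 cov]]]; suff : ~~ true by [].
rewrite -[true]refuted9_two_small.
apply: (@covering_not_refuted T _ _ _ f1 f2 f3 _ 4 4) => //.
- by rewrite cT.
- by move=> v; rewrite -cT max_card.
- have [_ _ b3 _] := cov => v.
  have := @odd_degree T f3 2 4 v b3; rewrite cT => deg.
  suff : #|[set u | far 9 4 (f3 v) (f3 u)]| + 2 <= 4 by rewrite addn2.
  apply: deg => c cp.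
  exact: (@card_window_le T (9, 4) (8, 3) (9, 4) f3 f2 f1 4 c isT isT (covering_swap13 cov) cp).
- by rewrite cT; exact: profiles9_two_smallP.
Qed.

(** * Bounds for rational parameters *)

Lemma packing_swap12 (T : finType) r1 r2 r3 : packing T r1 r2 r3 -> packing T r2 r1 r3.
Proof.
by case=> e1 [e2 [e3 [c1 c2 c3 cov]]]; exists e2, e1, e3; split=> // u v /cov; rewrite orbCA.
Qed.

Lemma packing_swap23 (T : finType) r1 r2 r3 : packing T r1 r2 r3 -> packing T r1 r3 r2.
Proof.
case=> e1 [e2 [e3 [c1 c2 c3 cov]]]; exists e1, e3, e2; split=> // u v /cov.
by rewrite [e2 u v || _]orbC.
Qed.

Lemma alphaC12 (x y z : rat) : alpha [tuple x; y; z] = alpha [tuple y; x; z].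
Proof.
apply/eqP; rewrite eqn_leq; apply/andP.
by split; apply/alpha_packing/packing_swap12/alpha_packing.
Qed.

Lemma alphaC23 (x y z : rat) : alpha [tuple x; y; z] = alpha [tuple x; z; y].
Proof.
apply/eqP; rewrite eqn_leq; apply/andP.
by split; apply/alpha_packing/packing_swap23/alpha_packing.
Qed.

Section RationalBounds.
Local Open Scope ring_scope.

Lemma num_denE (x : rat) : 0 <= x -> x * (num_den x).2%:R = (num_den x).1%:R.
Proof.
move=> x0; rewrite /num_den /= !natr_absz (gtr0_norm (denq_gt0 x)) ger0_norm ?numq_ge0 //.
by rewrite -{1}(divq_num_den x) divfK // intr_eq0 denq_neq0.
Qed.

Lemma num_den_gt0 (x : rat) : (0 < (num_den x).2)%N.
Proof. by rewrite absz_gt0 denq_neq0. Qed.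

Lemma num_den_lt (x : rat) (a b : nat) : 0 <= x ->
  (x * b%:R < a%:R) = ((num_den x).1 * b < (num_den x).2 * a)%N.
Proof.
move=> x0; have q0 : 0 < (num_den x).2%:R :> rat by rewrite ltr0n num_den_gt0.
by rewrite -(ltr_nat rat) !natrM -(num_denE x0) mulrAC [_ * a%:R]mulrC ltr_pM2r.
Qed.

Lemma num_den_ge2 (x : rat) : 2 <= x -> ((num_den x).2.*2 <= (num_den x).1)%N.
Proof.
move=> x2; have x0 : 0 <= x by apply: le_trans x2.
rewrite leqNgt -muln2 -[X in (X < _)%N]muln1 -num_den_lt //.
by rewrite mulr1 -leNgt.
Qed.

(** Averaging first over x, where windows hold one point, then over y, then over z. *)
Lemma averaging_bound (x y z : rat) (M1 M2 M3 : nat) :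
  2 <= x -> 2 <= y -> 2 <= z ->
  x < M1.+1%:R -> y * M1%:R < M2.+1%:R -> z * M2%:R < M3.+1%:R ->
  (alpha [tuple x; y; z] <= M3)%N.
Proof.
move=> x2 y2 z2 ltx lty ltz.
have pos (w : rat) : 2 <= w -> 0 <= w by exact: le_trans.
have ok (w : rat) : 2 <= w -> (0 < (num_den w).2 <= (num_den w).1)%N.
  by move=> w2; have := num_den_gt0 w; have := num_den_ge2 w2; lia.
have {}ltx : x * 1%:R < M1.+1%:R by rewrite mulr1.
rewrite num_den_lt ?pos // in ltx.
rewrite num_den_lt ?pos // in lty; rewrite num_den_lt ?pos // in ltz.
have /alpha_packing[e1 [e2 [e3 [c1 c2 c3 cov]]]] := leqnn (alpha [tuple x; y; z]).
have b0 : clique_bound (fun _ _ : 'I_(alpha [tuple x; y; z]) => false) 1.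
  exact: clique_bound0.
have b1 := clique_boundU (ok x x2) c1 b0 ltx.
have b2 := clique_boundU (ok y y2) c2 b1 lty.
rewrite -[X in (X <= _)%N]card_ord -cardsT.
apply: (clique_boundU (ok z z2) c3 b2 ltz) => u v _ _ uv.
by have := cov u v uv; rewrite orbF; case/or3P => ->; rewrite ?orbT.
Qed.

End RationalBounds.

Definition rounds_to n a b P Q : bool :=
  all (fun p => all (fun q => (q.*2 <= p) && (p * b < a * q) ==> (p * Q <= P * q))
    (iota 1 n)) (iota 0 n.+1).

Lemma circ_round (T : finType) (e : rel T) (x : rat) n a b P Q :
  (2 <= x)%R -> #|T| = n -> 1 < n -> 0 < P -> (x * b%:R < a%:R)%R -> rounds_to n a b P Q ->
  circ_colourable (num_den x) e -> circ_colourable (P, Q) e.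
Proof.
move=> x2 cT n1 P0; rewrite num_den_lt; last by apply: le_trans x2.
move=> lt round /(circ_reduce (num_den_gt0 x) (num_den_ge2 x2)).
rewrite cT (maxn_idPr n1) => -[[p q] /= [pn q0 qp le ce]].
apply: circ_le ce => //.
have /allP/(_ p) := round; rewrite mem_iota /= add0n ltnS pn => /(_ isT)/allP/(_ q).
rewrite mem_iota q0 add1n ltnS qp /=.
have -> : q <= n by lia.
move=> /(_ isT)/implyP; apply.
have q1 := num_den_gt0 x.
rewrite -(ltn_pmul2r q1) mulnAC; apply: (@leq_ltn_trans ((num_den x).1 * q * b)).
  by rewrite leq_mul2r le orbT.
by rewrite mulnAC [ltnRHS]mulnC mulnA ltn_pmul2r.
Qed.

Lemma packing_round (T : finType) (x y z : rat) n a1 b1 r1 a2 b2 r2 a3 b3 r3 :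
  (2 <= x)%R -> (2 <= y)%R -> (2 <= z)%R -> #|T| = n -> 1 < n ->
  [&& 0 < r1.1, 0 < r2.1 & 0 < r3.1] ->
  (x * b1%:R < a1%:R)%R -> (y * b2%:R < a2%:R)%R -> (z * b3%:R < a3%:R)%R ->
  [&& rounds_to n a1 b1 r1.1 r1.2, rounds_to n a2 b2 r2.1 r2.2 &
      rounds_to n a3 b3 r3.1 r3.2] ->
  packing T (num_den x) (num_den y) (num_den z) -> packing T r1 r2 r3.
Proof.
case: r1 r2 r3 => [P1 Q1] [P2 Q2] [P3 Q3] x2 y2 z2 cT n1 /and3P[p1 p2 p3].
move=> l1 l2 l3 /and3P[d1 d2 d3].
case=> e1 [e2 [e3 [c1 c2 c3 cov]]]; exists e1, e2, e3; split=> //.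
- exact: circ_round l1 d1 c1.
- exact: circ_round l2 d2 c2.
- exact: circ_round l3 d3 c3.
Qed.

Section HardBounds.
Local Open Scope ring_scope.
Variables x y z : rat.
Hypotheses (x2 : 2 <= x) (y2 : 2 <= y) (z2 : 2 <= z).

(** In these five bounds an open condition on a parameter is replaced by the largest
    fraction that meets it with a numerator at most the number of points: among 13 points,
    for instance, 8/3 stands for x < 11/4 and 11/4 stands for y < 3. *)
Lemma alpha_le12 : x < 11 / 4 -> y < 3 -> z < 3 -> (alpha [tuple x; y; z] <= 12)%N.
Proof.
move=> lx ly lz; rewrite leqNgt; apply/negP => /alpha_packing pack.
apply: (@no_packing13 'I_13 (card_ord _)).
by apply: (@packing_round _ x y z 13 11 4 (8, 3)%N 3 1 (11, 4)%N 3 1 (11, 4)%N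
  x2 y2 z2 (card_ord _) isT isT _ _ _ _ pack); [lra|lra|lra|vm_compute].
Qed.

Lemma alpha_le11 : x < 8 / 3 -> y < 3 -> z < 3 -> (alpha [tuple x; y; z] <= 11)%N.
Proof.
move=> lx ly lz; rewrite leqNgt; apply/negP => /alpha_packing pack.
apply: (@no_packing12 'I_12 (card_ord _)).
by apply: (@packing_round _ x y z 12 8 3 (5, 2)%N 3 1 (11, 4)%N 3 1 (11, 4)%N
  x2 y2 z2 (card_ord _) isT isT _ _ _ _ pack); [lra|lra|lra|vm_compute].
Qed.

Lemma alpha_le10 : x < 8 / 3 -> y < 8 / 3 -> z < 8 / 3 -> (alpha [tuple x; y; z] <= 10)%N.
Proof.
move=> lx ly lz; rewrite leqNgt; apply/negP => /alpha_packing pack.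
apply: (@no_packing11 'I_11 (card_ord _)).
by apply: (@packing_round _ x y z 11 8 3 (5, 2)%N 8 3 (5, 2)%N 8 3 (5, 2)%N
  x2 y2 z2 (card_ord _) isT isT _ _ _ _ pack); [lra|lra|lra|vm_compute].
Qed.

Lemma alpha_le8_all_small :
  x < 5 / 2 -> y < 5 / 2 -> z < 5 / 2 -> (alpha [tuple x; y; z] <= 8)%N.
Proof.
move=> lx ly lz; rewrite leqNgt; apply/negP => /alpha_packing pack.
apply: (@no_packing9_all_small 'I_9 (card_ord _)).
by apply: (@packing_round _ x y z 9 5 2 (7, 3)%N 5 2 (7, 3)%N 5 2 (7, 3)%N
  x2 y2 z2 (card_ord _) isT isT _ _ _ _ pack); [lra|lra|lra|vm_compute].
Qed.

Lemma alpha_le8_two_small :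
  x < 7 / 3 -> y < 7 / 3 -> z < 3 -> (alpha [tuple x; y; z] <= 8)%N.
Proof.
move=> lx ly lz; rewrite leqNgt; apply/negP => /alpha_packing pack.
apply: (@no_packing9_two_small 'I_9 (card_ord _)); apply: packing_swap23.
by apply: (@packing_round _ x y z 9 7 3 (9, 4)%N 7 3 (9, 4)%N 3 1 (8, 3)%N
  x2 y2 z2 (card_ord _) isT isT _ _ _ _ pack); [lra|lra|lra|vm_compute].
Qed.

End HardBounds.

(** * The twelve values as lower bounds *)

Definition separated (r1 r2 r3 : nat * nat) (a b : nat * nat * nat) : bool :=
  [|| far r1.1 r1.2 a.1.1 b.1.1, far r2.1 r2.2 a.1.2 b.1.2 | far r3.1 r3.2 a.2 b.2].

Definition is_packing (r1 r2 r3 : nat * nat) (s : seq (nat * nat * nat)) : bool :=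
  all (fun a => [&& a.1.1 < r1.1, a.1.2 < r2.1 & a.2 < r3.1]) s &&
  pairwise (separated r1 r2 r3) s.

Lemma is_packing_alpha (x y z : rat) s :
  is_packing (num_den x) (num_den y) (num_den z) s -> size s <= alpha [tuple x; y; z].
Proof.
case/andP=> /allP bd /(pairwiseP (0, 0, 0)) sep; apply/alpha_packing.
pose c i := nth (0, 0, 0) s i.
have cb (i : 'I_(size s)) : [&& (c i).1.1 < (num_den x).1, (c i).1.2 < (num_den y).1
    & (c i).2 < (num_den z).1] by apply: bd; exact: mem_nth.
exists (fun (i j : 'I_(size s)) => far (num_den x).1 (num_den x).2 (c i).1.1 (c j).1.1),
  (fun (i j : 'I_(size s)) => far (num_den y).1 (num_den y).2 (c i).1.2 (c j).1.2),
  (fun (i j : 'I_(size s)) => far (num_den z).1 (num_den z).2 (c i).2 (c j).2); split.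
- by exists (fun i : 'I_(size s) => (c i).1.1) => // i; case/and3P: (cb i).
- by exists (fun i : 'I_(size s) => (c i).1.2) => // i; case/and3P: (cb i).
- by exists (fun i : 'I_(size s) => (c i).2) => // i; case/and3P: (cb i).
move=> i j ij; have : (i : nat) != j by [].
rewrite neq_ltn => /orP[] lt; first exact: sep (ltn_ord i) (ltn_ord j) lt.
by case/or3P: (sep j i (ltn_ord j) (ltn_ord i) lt); rewrite far_sym => ->; rewrite ?orbT.
Qed.

Definition grid (a b c : nat) : seq (nat * nat * nat) :=
  [seq (ij, k) | ij <- [seq (i, j) | i <- iota 0 a, j <- iota 0 b], k <- iota 0 c].

Local Open Scope ring_scope.

(** The five points of slope 2 form a maximum independent set of the strong square of the
    five-cycle. *)
Definition pentagon : seq (nat * nat) := [seq (i, (2 * i) %% 5)%N | i <- iota 0 5].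

Definition cyclic_packing (n a b : nat) : seq (nat * nat * nat) :=
  [seq (i, (a * i) %% n, (b * i) %% n)%N | i <- iota 0 n].

Lemma alpha_ge_values t : t \in twelve_points -> (t.2 <= alpha t.1)%N.
Proof.
rewrite !inE; do ![case/orP] => /eqP -> /=.
- by apply: (@is_packing_alpha 2 2 2 (grid 2 2 2)); vm_compute.
- by apply: (@is_packing_alpha 2 2 3 (grid 2 2 3)); vm_compute.
- by apply: (@is_packing_alpha 2 3 3 (grid 2 3 3)); vm_compute.
- by apply: (@is_packing_alpha 2 (5 / 2) (5 / 2)
    [seq (i, a.1, a.2) | i <- iota 0 2, a <- pentagon]); vm_compute.
- by apply: (@is_packing_alpha (5 / 2) (5 / 2) 3
    [seq (a.1, a.2, i) | i <- iota 0 3, a <- pentagon]); vm_compute.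
- by apply: (@is_packing_alpha (9 / 4) (7 / 3) (5 / 2)
    [:: (0, 0, 0); (1, 3, 1); (2, 6, 2); (3, 2, 3); (4, 5, 4); (5, 2, 1); (6, 5, 2);
        (7, 1, 3); (8, 4, 4)]%N); vm_compute.
- by apply: (@is_packing_alpha (5 / 2) (5 / 2) (8 / 3)
    [:: (0, 2, 4); (0, 3, 7); (1, 1, 7); (1, 4, 2); (2, 1, 2); (2, 4, 5); (3, 2, 5);
        (3, 3, 0); (4, 0, 6); (4, 1, 1); (4, 4, 3)]%N); vm_compute.
- by apply: (@is_packing_alpha (8 / 3) (8 / 3) (8 / 3)
    [:: (0, 1, 3); (0, 6, 1); (1, 0, 6); (1, 3, 0); (2, 4, 5); (3, 0, 1); (4, 5, 2);
        (4, 7, 5); (5, 2, 4); (5, 4, 7); (6, 1, 0); (7, 5, 4)]%N); vm_compute.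
- by apply: (@is_packing_alpha (11 / 5) (11 / 4) (11 / 4) (cyclic_packing 11 2 4));
    vm_compute.
- by apply: (@is_packing_alpha (11 / 4) (11 / 4) (11 / 4)
    [:: (0, 0, 0); (1, 7, 9); (2, 3, 6); (2, 10, 4); (3, 6, 2); (4, 2, 10); (5, 9, 8);
        (6, 2, 3); (7, 9, 1); (8, 5, 9); (9, 1, 7); (9, 8, 5); (10, 4, 2)]%N); vm_compute.
- by apply: (@is_packing_alpha (14 / 5) (14 / 5) (14 / 5) (cyclic_packing 14 3 5));
    vm_compute.
- by apply: (@is_packing_alpha 3 3 3 (grid 3 3 3)); vm_compute.
Qed.

(** * The step function on the cube *)

Definition dominates (u v : 3.-tuple rat) : bool := all2 (fun a b => a <= b) u v.

Lemma lt_or_le (a b : rat) : a < b \/ b <= a.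
Proof. by case: (ltP a b) => h; [left|right]. Qed.

(** Each branch of the case analysis selects the listed point of largest value below
    (x, y, z).  Outside the five exceptional regions the order in which the coordinates
    are averaged is chosen so that the intermediate roundings give the value exactly. *)
Lemma classification (x y z : rat) : 2 <= x -> x <= y -> y <= z -> z <= 3 ->
  exists2 t, t \in twelve_points &
    dominates t.1 [tuple x; y; z] /\ (alpha [tuple x; y; z] <= t.2)%N.
Proof.
move=> x2 xy yz z3; have y2 := le_trans x2 xy; have z2 := le_trans y2 yz.
(* The position k in the list determines the listed point and its value. *)
have pick k a b c n : nth ([tuple 0; 0; 0], 0%N) twelve_points k = ([tuple a; b; c], n) ->
    (k < 12)%N -> a <= x -> b <= y -> c <= z -> (alpha [tuple x; y; z] <= n)%N ->
    exists2 t, t \in twelve_points &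
      dominates t.1 [tuple x; y; z] /\ (alpha [tuple x; y; z] <= t.2)%N.
  move=> eqk k12 h1 h2 h3 le; exists ([tuple a; b; c], n).
    by rewrite -eqk; exact: mem_nth.
  by split=> //; rewrite /dominates /= h1 h2 h3.
have [z3'|z3'] := lt_or_le z 3; last first.
  have [y3|y3] := lt_or_le y 3; last first.
    have [x3|x3] := lt_or_le x 3.
      apply: (pick 2%N _ _ _ _ erefl isT); [lra|lra|lra|].
      by apply: (@averaging_bound _ _ _ 2 6); lra.
    apply: (pick 11%N _ _ _ _ erefl isT); [lra|lra|lra|].
    by apply: (@averaging_bound _ _ _ 3 9); lra.
  have [xh|xh] := lt_or_le x (5 / 2).
    apply: (pick 1%N _ _ _ _ erefl isT); [lra|lra|lra|].
    by rewrite alphaC12; apply: (@averaging_bound _ _ _ 2 4); lra.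
  apply: (pick 4%N _ _ _ _ erefl isT); [lra|lra|lra|].
  by apply: (@averaging_bound _ _ _ 2 5); lra.
have [x145|x145] := lt_or_le x (14 / 5); last first.
  apply: (pick 10%N _ _ _ _ erefl isT); [lra|lra|lra|].
  by apply: (@averaging_bound _ _ _ 2 5); lra.
have [x114|x114] := lt_or_le x (11 / 4); last first.
  apply: (pick 9%N _ _ _ _ erefl isT); [lra|lra|lra|].
  by rewrite alphaC12 alphaC23; apply: (@averaging_bound _ _ _ 2 5); lra.
have [x83|x83] := lt_or_le x (8 / 3); last first.
  by apply: (pick 7%N _ _ _ _ erefl isT); [lra|lra|lra|apply: alpha_le12; lra].
have [x52|x52] := lt_or_le x (5 / 2); last first.
  have [z83|z83] := lt_or_le z (8 / 3).
    by apply: (pick 3%N _ _ _ _ erefl isT); [lra|lra|lra|apply: alpha_le10; lra].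
  by apply: (pick 6%N _ _ _ _ erefl isT); [lra|lra|lra|apply: alpha_le11; lra].
have [y114|y114] := lt_or_le y (11 / 4); last first.
  have [x115|x115] := lt_or_le x (11 / 5); last first.
    by apply: (pick 8%N _ _ _ _ erefl isT); [lra|lra|lra|apply: alpha_le11; lra].
  apply: (pick 3%N _ _ _ _ erefl isT); [lra|lra|lra|].
  by rewrite alphaC12 alphaC23; apply: (@averaging_bound _ _ _ 2 5); lra.
have [y52|y52] := lt_or_le y (5 / 2); last first.
  apply: (pick 3%N _ _ _ _ erefl isT); [lra|lra|lra|].
  by rewrite alphaC23 alphaC12; apply: (@averaging_bound _ _ _ 2 4); lra.
have [x94|x94] := lt_or_le x (9 / 4).
  apply: (pick 0%N _ _ _ _ erefl isT); [lra|lra|lra|].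
  by rewrite alphaC12 alphaC23 alphaC12; apply: (@averaging_bound _ _ _ 2 4); lra.
have [y73|y73] := lt_or_le y (7 / 3).
  by apply: (pick 0%N _ _ _ _ erefl isT); [lra|lra|lra|apply: alpha_le8_two_small; lra].
have [z52|z52] := lt_or_le z (5 / 2).
  by apply: (pick 0%N _ _ _ _ erefl isT); [lra|lra|lra|apply: alpha_le8_all_small; lra].
apply: (pick 5%N _ _ _ _ erefl isT); [lra|lra|lra|].
by rewrite alphaC23 alphaC12; apply: (@averaging_bound _ _ _ 2 4); lra.
Qed.

(** Both the exactness of the values and the strict drop below each listed point reduce to
    this finite comparison of the listed points with each other. *)
Lemma dominates_strict :
  all (fun t => all (fun t' => dominates t'.1 t.1 ==> ((t' == t) || (t'.2 < t.2)%N))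
    twelve_points) twelve_points.
Proof. by vm_compute. Qed.

Lemma twelve_points_sorted :
  all (fun t : 3.-tuple rat * nat =>
    all (fun a : rat => 2 <= a <= 3) t.1 && sorted (<=%O : rel rat) t.1) twelve_points.
Proof. by vm_compute. Qed.

(** * From sorted triples to all triples *)

Lemma perm2P (y z b c : rat) :
  perm_eq [:: y; z] [:: b; c] -> (y = b /\ z = c) \/ (y = c /\ z = b).
Proof.
move=> h; have : y \in [:: b; c] by rewrite -(perm_mem h) inE eqxx.
rewrite !inE => /orP[] /eqP E; subst y.
  by left; split=> //; move: h; rewrite perm_cons => /(@perm_small_eq _ _ [:: _] isT)[].
right; split=> //; move: h; rewrite (permPr (permEl (perm_catC [:: b] [:: c]))) perm_cons.
by move=> /(@perm_small_eq _ _ [:: _] isT)[].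
Qed.

Lemma perm3P (x y z a b c : rat) : perm_eq [:: x; y; z] [:: a; b; c] ->
  [\/ x = a /\ perm_eq [:: y; z] [:: b; c], x = b /\ perm_eq [:: y; z] [:: a; c]
    | x = c /\ perm_eq [:: y; z] [:: a; b]].
Proof.
move=> h; have : x \in [:: a; b; c] by rewrite -(perm_mem h) inE eqxx.
rewrite !inE => /or3P[] /eqP E; subst x.
- by constructor 1; split=> //; rewrite perm_cons in h.
- constructor 2; split=> //; rewrite -(perm_cons b); apply: perm_trans h _.
  by rewrite (perm_catCA [:: a] [:: b] [:: c]).
constructor 3; split=> //; rewrite -(perm_cons c); apply: perm_trans h _.
by rewrite (perm_catC [:: a; b] [:: c]).
Qed.

Lemma tuple3P (v : 3.-tuple rat) : exists x y z, v = [tuple x; y; z].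
Proof.
case: v => -[|x [|y [|z [|? ?]]]] // sz; exists x, y, z; exact: val_inj.
Qed.

Lemma alpha_perm (v w : 3.-tuple rat) : perm_eq v w -> alpha v = alpha w.
Proof.
have [x [y [z ->]]] := tuple3P v; have [a [b [c ->]]] := tuple3P w.
case/perm3P=> -[-> /perm2P[] [-> ->]] //.
- exact: alphaC23.
- exact: alphaC12.
- by rewrite alphaC23 alphaC12.
- by rewrite alphaC12 alphaC23.
- by rewrite alphaC12 alphaC23 alphaC12.
Qed.

(** Among all permutations, sorting both triples is the best way to compare them. *)
Lemma perm_le_sorted (a b c x y z : rat) : a <= b -> b <= c -> x <= y -> y <= z ->
  perm_le [tuple a; b; c] [tuple x; y; z] -> [/\ a <= x, b <= y & c <= z].
Proof.
move=> ab bc xy yz [w]; have [w0 [w1 [w2 ->]]] := tuple3P w.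
move=> pw le; have := le ord0; have := le (lift ord0 ord0).
have := le (lift ord0 (lift ord0 ord0)).
rewrite !(tnth_nth 0) /= => l2 l1 l0 {le}.
by case/perm3P: pw l0 l1 l2 => -[-> /perm2P[] [-> ->]] *; split; lra.
Qed.

Lemma sort3 (v : 3.-tuple rat) :
  exists x y z, [/\ x <= y, y <= z & perm_eq v [tuple x; y; z]].
Proof.
have [x [y [z E]]] := tuple3P [tuple of sort (<=%O : rel rat) v]; exists x, y, z.
have Ev : sort (<=%O : rel rat) v = [:: x; y; z] := congr1 val E.
have := sort_le_sorted v; rewrite Ev /= andbT => /andP[xy yz].
by split=> //; rewrite /= -Ev perm_sym perm_sort.
Qed.

Lemma perm_le_permr k (u v w : k.-tuple rat) : perm_eq w v -> perm_le u v -> perm_le u w.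
Proof.
move=> /tuple_permP[s ws] [u' pu' le]; exists [tuple tnth u' (s i) | i < k].
  by apply: perm_trans pu'; apply/tuple_permP; exists s.
move=> i; have -> : w = [tuple tnth v (s i) | i < k] by exact: val_inj.
by rewrite !tnth_mktuple.
Qed.

Lemma perm_le_perml k (u v w : k.-tuple rat) : perm_eq u w -> perm_le u v -> perm_le w v.
Proof. by move=> uw [u' pu' le]; exists u' => //; apply: perm_trans pu' uw. Qed.

Lemma perm_range k (u v : k.-tuple rat) (P : pred rat) :
  perm_eq u v -> (forall i, P (tnth u i)) -> forall i, P (tnth v i).
Proof. by move=> uv /all_tnthP Pu; apply/all_tnthP; rewrite -(perm_all _ uv). Qed.

Lemma dominates_perm_le (u v : 3.-tuple rat) : dominates u v -> perm_le u v.
Proof.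
have [a [b [c ->]]] := tuple3P u; have [x [y [z ->]]] := tuple3P v.
rewrite /dominates /= andbT => /and3P[ax bL cz]; exists [tuple a; b; c] => //.
by case=> -[|[|[|m]]] // i3; rewrite !(tnth_nth 0).
Qed.

Lemma twelve_point_below (v : 3.-tuple rat) : (forall i, 2 <= tnth v i <= 3) ->
  exists2 t, t \in twelve_points & perm_le t.1 v /\ (alpha v <= t.2)%N.
Proof.
move=> rv; have [x [y [z [xy yz pv]]]] := sort3 v.
have rs := perm_range (P := fun a => 2 <= a <= 3) pv rv.
have x2 : 2 <= x by case/andP: (rs ord0).
have z3 : z <= 3 by case/andP: (rs ord_max); rewrite (tnth_nth 0).
have [t tin [dom le]] := classification x2 xy yz z3; exists t => //.
rewrite (alpha_perm pv); split=> //.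
apply: perm_le_permr pv _; exact: dominates_perm_le.
Qed.

Lemma twelve_pointsP t : t \in twelve_points ->
  exists a b c, [/\ t.1 = [tuple a; b; c], 2 <= a, a <= b, b <= c & c <= 3].
Proof.
move=> tin; have /allP/(_ t tin)/andP[] := twelve_points_sorted.
have [a [b [c E]]] := tuple3P t.1; rewrite E /=.
move=> /and4P[/andP[a2 _] _ /andP[_ c3] _] /and3P[ab bc _].
by exists a, b, c.
Qed.

Lemma twelve_points_range t : t \in twelve_points -> forall i, 2 <= tnth t.1 i <= 3.
Proof.
move=> /twelve_pointsP[a [b [c [-> a2 ab bc c3]]]].
by case=> -[|[|[|m]]] // i3; rewrite (tnth_nth 0) /=; lra.
Qed.

Lemma alpha_twelve t : t \in twelve_points -> alpha t.1 = t.2.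
Proof.
move=> tin; apply/eqP; rewrite eqn_leq alpha_ge_values // andbT.
have [a [b [c [E a2 ab bc c3]]]] := twelve_pointsP tin.
have [t' t'in [dom le]] := classification a2 ab bc c3.
rewrite E; apply: leq_trans le _.
have /allP/(_ t tin)/allP/(_ t' t'in)/implyP := dominates_strict.
by rewrite E => /(_ dom)/orP[/eqP->|/ltnW].
Qed.

(** A triple u strictly below t has a listed point t' below it with alpha u at most the value
    of t'.  If t' were t, then u would be squeezed between t and t. *)
Lemma twelve_discontinuity t : t \in twelve_points -> discontinuity t.1.
Proof.
move=> tin; have rt := twelve_points_range tin.
split=> [i|u u2 [ut nut]]; first by case/andP: (rt i).
have [a [b [c [ab bc pu]]]] := sort3 u.
have [x [y [z [E x2 xy yz z3]]]] := twelve_pointsP tin.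
have [ax bL cz] : [/\ a <= x, b <= y & c <= z].
  by apply: perm_le_sorted => //; rewrite -E; apply: perm_le_perml ut.
have a2 : 2 <= a := perm_range (P := fun w => 2 <= w) pu u2 ord0.
have [t' t'in [dom le]] := classification a2 ab bc (le_trans cz z3).
rewrite (alpha_perm pu) alpha_twelve //; apply: leq_ltn_trans le _.
have /allP/(_ t tin)/allP/(_ t' t'in)/implyP := dominates_strict.
move: dom; have [p [q [r E']]] := tuple3P t'.1; rewrite E' E /dominates /= !andbT.
move=> /and3P[pa qb rc].
rewrite (le_trans pa ax) (le_trans qb bL) (le_trans rc cz) => /(_ isT)/orP[/eqP tt|//].
case/negP: nut; rewrite tt E in E'; case: E' => xp yq zr.
rewrite E (perm_trans pu) //.
have -> : a = x by apply/le_anti; rewrite ax xp.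
have -> : b = y by apply/le_anti; rewrite bL yq.
by have -> : c = z by apply/le_anti; rewrite cz zr.
Qed.

Theorem theorem1p7 :
  (forall v : 3.-tuple rat,
     ((forall i : 'I_3, 2 <= tnth v i <= 3) /\ discontinuity v) <->
     (exists2 t, t \in twelve_points & perm_eq v t.1)) /\
  (forall t, t \in twelve_points -> alpha t.1 = t.2).
Proof.
split; last exact: alpha_twelve.
move=> v; split=> [[rv [v2 dv]]|[t tin pvt]].
  have [t tin [le le_alpha]] := twelve_point_below rv; exists t => //.
  apply/negPn/negP => npv; move: le_alpha.
  rewrite -alpha_twelve // leqNgt dv //; last by split=> //; rewrite perm_sym.
  by move=> i; case/andP: (twelve_points_range tin i).
have ptv : perm_eq t.1 v by rewrite perm_sym.
have rt := twelve_points_range tin.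
have rv := perm_range (P := fun a => 2 <= a <= 3) ptv rt.
split=> //; split=> [i|u u2 [uv nuv]]; first by case/andP: (rv i).
have [_ dt] := twelve_discontinuity tin.
rewrite (alpha_perm pvt); apply: dt => //; split; first exact: perm_le_permr uv.
by apply: contra nuv => /perm_trans; apply.
Qed.
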